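(* Let $F$ be a PMT. Then $\mathrm{Per_{rep}}(F)\cup\mathrm{Per_{par}}(F)\subset\alpha(F)\subset\mathcal B(F)$, $\mathrm{Per_{attr}}(F)\cup\mathrm{Per_{par}}(F)\cup\mathrm{Per_{ell}}(F)\cup\mathrm{Per_{id}}(F)\subset\omega(F)$, and $\mathrm{Per_{attr}}(F)\cup\mathrm{Per_{ell}}(F)\cup\mathrm{Per_{id}}(F)\subset\mathcal R(F)$.
   Context: A piecewise Möbius transformation (PMT) is a pair $(P,F)$ where $P=\{R_k\}_{k=1}^K$ is a finite collection of nonempty, open, connected, pairwise disjoint subsets (''regions'') of the Riemann sphere $\widehat{\mathbb C}$, each $\partial R_k$ being a union of piecewise smooth simple closed curves, with $\bigcup_{k}\overline{R_k}=\widehat{\mathbb C}$; and $F$ is defined on the region of conformality $R(F)=\bigcup_k R_k$ by $F|_{R_k}=f_k|_{R_k}$, where each $f_k\in PSL(2,\mathbb C)$ is a Möbius transformation, while $F$ is undefined on the discontinuity set $B(F)=\bigcup_k\partial R_k$. The partition is minimal: if $\overline{R_k}\cap\overline{R_j}\neq\emptyset$ is a union of curves then $f_k\neq f_j$. For $A\subset\widehat{\mathbb C}$, $F^{-n}(A)$ is the set of $z$ with $F^j(z)\in R(F)$ for $0\le j<n$ and $F^n(z)\in A$. The pre-discontinuity set is $\mathcal B(F)=\overline{\bigcup_{n\ge0}F^{-n}(B(F))}$, the regular set is $\mathcal R(F)=\widehat{\mathbb C}\setminus\mathcal B(F)$, the $\alpha$-limit set is $\alpha(F)=\mathcal B(F)\setminus\bigcup_{n\ge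 0}F^{-n}(B(F))$, and $\omega(F)=\bigcup_{z\in\mathcal R(F)}\omega(z,F)$ where $\omega(z,F)$ is the set of accumulation points of $(F^n(z))_{n\ge0}$. A point $z$ is periodic of period $n\ge1$ if $F^j(z)\in R(F)$ for all $j\ge0$ and $F^n(z)=z$; writing $F^{j-1}(z)\in R_{k_j}$, the Möbius map $M_z=f_{k_n}\circ\cdots\circ f_{k_1}$ fixes $z$. Let $m$ be the multiplier of $M_z$ at $z$ (in a local coordinate). The periodic point is: of identity ($\mathrm{Per_{id}}(F)$) if there is a neighborhood $U$ of $z$ on which $F^n$ is defined and equals the identity; otherwise attracting ($\mathrm{Per_{attr}}(F)$) if $|m|<1$, repelling ($\mathrm{Per_{rep}}(F)$) if $|m|>1$, elliptic ($\mathrm{Per_{ell}}(F)$) if $|m|=1$, $m\ne1$, parabolic ($\mathrm{Per_{par}}(F)$) if $m=1$ and $M_z\neq\mathrm{id}$. *)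

(* Defs.v *)
From HB Require Import structures.
From mathcomp Require Import all_boot all_order all_algebra.
From mathcomp Require Import all_classical all_reals all_analysis.
From mathcomp Require Import complex.

Set Implicit Arguments.
Unset Strict Implicit.
Unset Printing Implicit Defensive.

Import Order.TTheory GRing.Theory Num.Theory.
Local Open Scope classical_set_scope.
Local Open Scope ring_scope.

Section PMT.
Variable R : realType.

(* ---------- The Riemann sphere  C ∪ {∞}  (None = ∞) ---------- *)
Definition sphere := option R[i].

Definition csq (z : R[i]) : R := let: Complex a b := z in a ^+ 2 + b ^+ 2.
Definition reP (z : R[i]) : R := let: Complex a _ := z in a.
Definition imP (z : R[i]) : R := let: Complex _ b := z in b.

Definition chordal (z w : sphere) : R :=
  match z, w with
  | Some z, Some w =>
      2 * Num.sqrt (csq (z - w)) / (Num.sqrt (1 + csq z) * Num.sqrt (1 + csq w))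
  | Some z, None => 2 / Num.sqrt (1 + csq z)
  | None, Some w => 2 / Num.sqrt (1 + csq w)
  | None, None => 0
  end.

Definition sball (z : sphere) (e : R) : set sphere := [set w | chordal z w < e].
Definition sopen (U : set sphere) :=
  forall z, U z -> exists2 e : R, 0 < e & sball z e `<=` U.
Definition sinterior (A : set sphere) : set sphere :=
  [set z | exists2 e : R, 0 < e & sball z e `<=` A].
Definition sclosure (A : set sphere) : set sphere :=
  [set z | forall e : R, 0 < e -> exists w, A w /\ chordal z w < e].
Definition sboundary (A : set sphere) : set sphere := sclosure A `\` sinterior A.
Definition sconnected (A : set sphere) :=
  forall U V, sopen U -> sopen V -> A `<=` U `|` V -> A `&` U `&` V = set0 ->
    A `&` U !=set0 -> A `&` V !=set0 -> False.

Definition scont_at (g : R -> sphere) (t : R) :=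
  forall e : R, 0 < e -> exists2 d : R, 0 < d &
    forall s, `|s - t| < d -> chordal (g s) (g t) < e.

Definition C1_near (h : R -> R) (t : R) :=
  exists2 d : R, 0 < d & forall s, `|s - t| < d ->
    derivable h s 1 /\ (derive1 h x @[x --> s] --> derive1 h s).

Definition chart0 (g : R -> sphere) : R -> R[i] := fun s => odflt 0 (g s).
Definition chartInf (g : R -> sphere) : R -> R[i] :=
  fun s => match g s with Some z => z^-1 | None => 0 end.

Definition smooth_near (g : R -> sphere) (t : R) :=
  ((exists2 d : R, 0 < d & forall s, `|s - t| < d -> g s <> None) /\
     C1_near (reP \o chart0 g) t /\ C1_near (imP \o chart0 g) t)
  \/
  ((exists2 d : R, 0 < d & forall s, `|s - t| < d -> g s <> Some 0) /\
     C1_near (reP \o chartInf g) t /\ C1_near (imP \o chartInf g) t).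

Definition pw_smooth_jordan (g : R -> sphere) :=
  [/\ forall t, scont_at g t,
      forall t, g (t + 1) = g t,
      forall s t, 0 <= s < 1 -> 0 <= t < 1 -> g s = g t -> s = t
    & exists P : seq R, forall t, 0 <= t <= 1 -> t \notin P -> smooth_near g t].

Definition arc (g : R -> sphere) :=
  (forall t, scont_at g t) /\
  (forall s t, 0 <= s <= 1 -> 0 <= t <= 1 -> g s = g t -> s = t).

Definition union_of_arcs (A : set sphere) :=
  exists G : set (R -> sphere), (forall g, G g -> arc g) /\
    A = [set z | exists2 g, G g & exists2 t, 0 <= t <= 1 & z = g t].

Definition mob := (R[i] * R[i] * R[i] * R[i])%type.
Definition mdet (M : mob) : R[i] := let: (a, b, c, d) := M in a * d - b * c.
Definition mid : mob := (1, 0, 0, 1).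
Definition mmul (M N : mob) : mob :=
  let: (a, b, c, d) := M in let: (a', b', c', d') := N in
  (a * a' + b * c', a * b' + b * d', c * a' + d * c', c * b' + d * d').

Definition mact (M : mob) (z : sphere) : sphere :=
  let: (a, b, c, d) := M in
  match z with
  | Some z => if c * z + d == 0 then None else Some ((a * z + b) / (c * z + d))
  | None => if c == 0 then None else Some (a / c)
  end.

(* multiplier of M at a fixed point z, i.e. the derivative of M at z in the
   chart w (z finite) or 1/w (z = ∞) *)
Definition mult (M : mob) (z : sphere) : R[i] :=
  let: (a, b, c, d) := M in
  match z with
  | Some w => (a * d - b * c) / (c * w + d) ^+ 2
  | None => d / a
  end.

Record PMT := {
  nreg : nat;
  reg : 'I_nreg -> set sphere;
  fmap : 'I_nreg -> mob;
  fmap_det : forall k, mdet (fmap k) != 0;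
  reg_ne : forall k, reg k !=set0;
  reg_open : forall k, sopen (reg k);
  reg_conn : forall k, sconnected (reg k);
  reg_disj : forall k j, k != j -> reg k `&` reg j = set0;
  reg_bdry : forall k, exists (m : nat) (g : nat -> R -> sphere),
      [/\ (0 < m)%N, forall i, (i < m)%N -> pw_smooth_jordan (g i)
        & sboundary (reg k) = [set z | exists2 i, (i < m)%N & exists t, z = g i t]];
  reg_cover : [set z | exists k, sclosure (reg k) z] = setT;
  reg_minimal : forall k j, k != j ->
      sclosure (reg k) `&` sclosure (reg j) !=set0 ->
      union_of_arcs (sclosure (reg k) `&` sclosure (reg j)) ->
      mact (fmap k) <> mact (fmap j)
}.

Arguments reg : clear implicits.
Arguments fmap : clear implicits.
Arguments nreg : clear implicits.

Variable F : PMT.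

Definition RF : set sphere := [set z | exists k, reg F k z].
Definition BF : set sphere := [set z | exists k, sboundary (reg F k) z].

Definition regionOf (z : sphere) : option 'I_(nreg F) := [pick k | `[< reg F k z >] ].
Definition mobAt (z : sphere) : mob :=
  if regionOf z is Some k then fmap F k else mid.
(* F itself (only meaningful on RF) *)
Definition Fmap (z : sphere) : sphere := mact (mobAt z) z.
Definition Fit (n : nat) (z : sphere) : sphere := iter n Fmap z.

Definition preim (n : nat) (A : set sphere) : set sphere :=
  [set z | (forall j, (j < n)%N -> RF (Fit j z)) /\ A (Fit n z)].

Definition preB_union : set sphere := [set z | exists n, preim n BF z].
Definition preB : set sphere := sclosure preB_union.
Definition regularF : set sphere := ~` preB.
Definition alphaF : set sphere := preB `\` preB_union.

Definition omega_pt (z : sphere) : set sphere :=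
  [set y | forall e : R, 0 < e -> forall N : nat,
     exists2 n, (N <= n)%N & chordal (Fit n z) y < e].
Definition omegaF : set sphere := [set y | exists2 z, regularF z & omega_pt z y].

Definition periodic (n : nat) (z : sphere) :=
  [/\ (0 < n)%N, forall j, RF (Fit j z) & Fit n z = z].

Fixpoint Mz (n : nat) (z : sphere) : mob :=
  if n is n'.+1 then mmul (mobAt (Fit n' z)) (Mz n' z) else mid.

Definition per_id_n (n : nat) (z : sphere) :=
  periodic n z /\ exists2 e : R, 0 < e & forall w, sball z e w ->
    (forall j, (j < n)%N -> RF (Fit j w)) /\ Fit n w = w.

Definition Per_id : set sphere := [set z | exists n, per_id_n n z].
Definition Per_attr : set sphere := [set z | exists n,
  [/\ periodic n z, ~ per_id_n n z & `|mult (Mz n z) z| < 1]].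
Definition Per_rep : set sphere := [set z | exists n,
  [/\ periodic n z, ~ per_id_n n z & `|mult (Mz n z) z| > 1]].
Definition Per_ell : set sphere := [set z | exists n,
  [/\ periodic n z, ~ per_id_n n z, `|mult (Mz n z) z| = 1 & mult (Mz n z) z != 1]].
Definition Per_par : set sphere := [set z | exists n,
  [/\ periodic n z, ~ per_id_n n z, mult (Mz n z) z = 1 & mact (Mz n z) <> id]].

End PMT.

(* Main.v *)
(* Mobius maps are Lipschitz for the chordal metric, and a fixed point of multiplier m <> 1 (resp. m = 1,
   M <> id) can be moved to 0 (resp. oo) so that M becomes x |-> m x (resp. x |-> x + 1).
   If a periodic point z has a neighbourhood missing the pre-discontinuity set, then along any radial path
   issued from z every F^n coincides with the Mobius map given by the itinerary of z. When the return map
   is repelling or parabolic its inverse iterates pull every point but at most one into that neighbourhood,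
   so the discontinuity set has at most one point; but it contains a Jordan curve.
   Conversely, small discs around attracting and elliptic points, and an attracting half-plane of a
   parabolic point, are invariant under the return map and follow the itinerary of z, hence are regular. *)
Require Import Defs.
From HB Require Import structures.
From mathcomp Require Import all_boot all_order all_algebra.
From mathcomp Require Import all_classical all_reals all_analysis.
From mathcomp Require Import complex.
From mathcomp Require Import ring lra.
Import Order.TTheory GRing.Theory Num.Theory.
Import numFieldNormedType.Exports.
Local Open Scope classical_set_scope.
Local Open Scope ring_scope.

Set Implicit Arguments.
Unset Strict Implicit.
Unset Printing Implicit Defensive.

Section RiemannSphere.
Variable R : realType.
Implicit Types (x y z : R[i]) (p q : sphere R) (M N : mob R).

(** * Modulus of complex numbers *)

Lemma csqM x y : csq (x * y) = csq x * csq y.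
Proof. by case: x => a b; case: y => c d /=; ring. Qed.

Lemma csq_ge0 x : 0 <= csq x.
Proof. by case: x => a b /=; rewrite addr_ge0 ?sqr_ge0. Qed.

Lemma csq_eq0 x : (csq x == 0) = (x == 0).
Proof.
case: x => a b /=; rewrite paddr_eq0 ?sqr_ge0// !sqrf_eq0.
by apply/andP/eqP => [[/eqP-> /eqP->]//|[-> ->]].
Qed.

Lemma csq_gt0 x : (0 < csq x) = (x != 0).
Proof. by rewrite lt_def csq_eq0 csq_ge0 andbT. Qed.

Lemma csqB x y : csq (x - y) = csq (y - x).
Proof. by case: x => a b; case: y => c d /=; ring. Qed.

Definition cabs x : R := Num.sqrt (csq x).

Lemma cabsM x y : cabs (x * y) = cabs x * cabs y.
Proof. by rewrite /cabs csqM sqrtrM // csq_ge0. Qed.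

Lemma cabs_ge0 x : 0 <= cabs x. Proof. exact: sqrtr_ge0. Qed.

Lemma cabs_gt0 x : (0 < cabs x) = (x != 0).
Proof. by rewrite sqrtr_gt0 csq_gt0. Qed.

Lemma cabsX x n : cabs (x ^+ n) = cabs x ^+ n.
Proof.
elim: n => [|n IH]; last by rewrite !exprS cabsM IH.
by rewrite !expr0 /cabs /= expr1n expr0n /= addr0 sqrtr1.
Qed.

Lemma normc_cabs x : `|x| = (cabs x)%:C%C.
Proof. by case: x. Qed.

Lemma sqr_cabs x : cabs x ^+ 2 = csq x.
Proof. by rewrite sqr_sqrtr // csq_ge0. Qed.

(* Homogeneous coordinates make the chordal metric and [mact] uniform at infinity. *)
Definition homx p : R[i] := if p is Some z then z else 1.
Definition homy p : R[i] := if p is Some _ then 1 else 0.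
Definition homn p : R := csq (homx p) + csq (homy p).

Lemma homn_gt0 p : 0 < homn p.
Proof.
case: p => [[a b]|]; rewrite /homn /=.
  by have := sqr_ge0 a; have := sqr_ge0 b; lra.
lra.
Qed.

Lemma chordal_ge0 p q : 0 <= chordal p q.
Proof.
case: p => [x|]; case: q => [y|] //=;
  rewrite ?divr_ge0 ?mulr_ge0 ?sqrtr_ge0 //.
Qed.

Lemma chordal_hom p q : chordal p q ^+ 2 =
  4 * csq (homx p * homy q - homy p * homx q) / (homn p * homn q).
Proof.
have one : csq (1 : R[i]) = 1 by rewrite /=; ring.
have zero : csq (0 : R[i]) = 0 by rewrite /=; ring.
have neg : csq (-1 : R[i]) = 1 by rewrite /=; ring.
have pos x : 0 <= 1 + csq x by rewrite addr_ge0 // csq_ge0.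
have sq1 : (2 : R) ^+ 2 = 4 by ring.
case: p => [x|]; case: q => [y|]; rewrite /chordal /homn /homx /homy.
- by rewrite !mulr1 mul1r expr_div_n !exprMn sq1 sqr_cabs !sqr_sqrtr // one ![csq _ + 1]addrC.
- by rewrite mulr0 mulr1 sub0r expr_div_n sqr_sqrtr // neg one zero addr0 !mulr1 sq1 addrC.
- by rewrite mul0r mulr1 subr0 expr_div_n sqr_sqrtr // one zero addr0 mul1r mulr1 sq1 addrC.
- by rewrite mul0r mulr0 subr0 zero mulr0 mul0r expr0n.
Qed.

Lemma chordalC p q : chordal p q = chordal q p.
Proof.
apply/eqP; rewrite -(eqrXn2 (n := 2)) ?chordal_ge0 //; apply/eqP.
by rewrite !chordal_hom csqB [_ * homn _]mulrC [homx q * _]mulrC [homy q * _]mulrC.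
Qed.

Lemma chordalxx p : chordal p p = 0.
Proof.
apply/eqP; rewrite -sqrf_eq0 chordal_hom [homy p * _]mulrC subrr.
by rewrite (eqP (_ : csq 0 == 0)) ?csq_eq0 // mulr0 mul0r.
Qed.

(** * Möbius maps as matrices acting on homogeneous coordinates *)

Definition mapx M p : R[i] := let: (a, b, c, d) := M in a * homx p + b * homy p.
Definition mapy M p : R[i] := let: (a, b, c, d) := M in c * homx p + d * homy p.

(** Numerator and denominator cannot vanish together when the determinant is nonzero. The factor [k]
    is the denominator, or the numerator when the image is infinity. *)
Lemma mact_hom M p : mdet M != 0 -> exists k, [/\ k != 0,
  mapx M p = k * homx (mact M p) & mapy M p = k * homy (mact M p)].
Proof.
case: M => [[[a b] c] d]; rewrite /mdet /mapx /mapy => dM.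
case: p => [x|] /=; rewrite ?mulr1 ?mulr0 ?addr0.
  have [e|ne] := eqVneq (c * x + d) 0; last first.
    by exists (c * x + d); rewrite ?(negPf ne) /= mulr1 [_ * (_ / _)]mulrC divfK.
  exists (a * x + b); rewrite ?e ?eqxx /= mulr1 mulr0; split=> //.
  apply: contra dM => /eqP e'.
  have -> : a * d - b * c = a * (c * x + d) - c * (a * x + b) by ring.
  by rewrite e e' !mulr0 subrr.
have [e|ne] := eqVneq c 0; last first.
  by exists c; rewrite ?(negPf ne) /= mulr1 [_ * (_ / _)]mulrC divfK.
exists a; rewrite ?e ?eqxx /= mulr1 mulr0; split=> //.
by apply: contra dM => /eqP e'; rewrite e e' mul0r mulr0 subrr.
Qed.

Lemma hom_inj p q (k l : R[i]) : k != 0 -> l != 0 ->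
  k * homx p = l * homx q -> k * homy p = l * homy q -> p = q.
Proof.
move=> k0 l0; case: p => [x|]; case: q => [y|] //=; rewrite ?mulr1 ?mulr0.
- by move=> + e; rewrite e => /(mulfI l0) ->.
- by move=> _ /eqP; rewrite (negPf k0).
- by move=> _ /esym/eqP; rewrite (negPf l0).
Qed.

Lemma mact_eq M p q k : mdet M != 0 -> k != 0 ->
  mapx M p = k * homx q -> mapy M p = k * homy q -> mact M p = q.
Proof.
move=> dM k0 ex ey; have [l [l0 lx ly]] := mact_hom p dM.
by apply: (@hom_inj _ _ l k) => //; rewrite -?ex -?ey.
Qed.

Lemma mdet_mul M N : mdet (mmul M N) = mdet M * mdet N.
Proof.
case: M => [[[a b] c] d]; case: N => [[[a' b'] c'] d'] /=; ring.
Qed.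

Lemma mact_mul M N p : mdet M != 0 -> mdet N != 0 ->
  mact (mmul M N) p = mact M (mact N p).
Proof.
move=> dM dN; have [k [k0 kx ky]] := mact_hom p dN.
have [l [l0 lx ly]] := mact_hom (mact N p) dM.
apply: (@mact_eq _ _ _ (k * l)); rewrite ?mdet_mul ?mulf_neq0 //.
  rewrite -mulrA -lx; move: kx ky; clear; case: M => [[[a b] c] d]; case: N => [[[a' b'] c'] d'] /= kx ky.
  transitivity (a * (a' * homx p + b' * homy p) + b * (c' * homx p + d' * homy p)); first by ring.
  by rewrite kx ky; ring.
rewrite -mulrA -ly; move: kx ky; clear; case: M => [[[a b] c] d]; case: N => [[[a' b'] c'] d'] /= kx ky.
transitivity (c * (a' * homx p + b' * homy p) + d * (c' * homx p + d' * homy p)); first by ring.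
by rewrite kx ky; ring.
Qed.

Definition mob_scale (k : R[i]) M : mob R := let: (a, b, c, d) := M in (k * a, k * b, k * c, k * d).

Lemma mdet_scale k M : mdet (mob_scale k M) = k ^+ 2 * mdet M.
Proof. by case: M => [[[a b] c] d] /=; ring. Qed.

Lemma mact_scale k M p : k != 0 -> mdet M != 0 -> mact (mob_scale k M) p = mact M p.
Proof.
move=> k0 dM; have [l [l0 lx ly]] := mact_hom p dM.
apply: (@mact_eq _ _ _ (k * l)); rewrite ?mdet_scale ?mulf_neq0 ?expf_neq0 //.
  by rewrite -mulrA -lx; clear; case: M => [[[a b] c] d] /=; ring.
by rewrite -mulrA -ly; clear; case: M => [[[a b] c] d] /=; ring.
Qed.

Definition madj M : mob R := let: (a, b, c, d) := M in (d, - b, - c, a).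

Lemma mdet_adj M : mdet (madj M) = mdet M.
Proof. by case: M => [[[a b] c] d] /=; ring. Qed.

Lemma mact1 p : mact (1, 0, 0, 1) p = p.
Proof. by case: p => [x|]; rewrite /= ?eqxx // mul0r add0r oner_eq0 mul1r addr0 divr1. Qed.

Lemma mactK M p : mdet M != 0 -> mact (madj M) (mact M p) = p.
Proof.
move=> dM; rewrite -mact_mul ?mdet_adj // -[RHS]mact1 -[RHS](@mact_scale (mdet M)) //.
  congr (mact _ p); clear; case: M => [[[a b] c] d] /=.
  by congr (_, _, _, _); ring.
by rewrite /= mul0r subr0 mulr1 oner_eq0.
Qed.

Lemma mactVK M p : mdet M != 0 -> mact M (mact (madj M) p) = p.
Proof.
move=> dM; have := @mactK (madj M) p; rewrite mdet_adj => /(_ dM).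
suff -> : madj (madj M) = M by [].
by case: (M) => [[[a b] c] d] /=; rewrite !opprK.
Qed.

(** * Lipschitz bound and Möbius charts *)

(** Cauchy-Schwarz, from Lagrange's identity: the two sides differ by the squared modulus of conj(x)
    w - conj(z) y, whose real and imaginary parts are the two squares below. *)
Lemma csq_lincomb x y z w :
  csq (x * y + z * w) <= (csq x + csq z) * (csq y + csq w).
Proof.
case: x => a b; case: y => c d; case: z => e f; case: w => g h /=.
have := sqr_ge0 (a * g + b * h - e * c - f * d).
have := sqr_ge0 (a * h - b * g - e * d + f * c).
lra.
Qed.

(** The squared Frobenius norm. *)
Definition mnorm M : R := let: (a, b, c, d) := M in csq a + csq b + csq c + csq d.

Lemma mnorm_ge0 M : 0 <= mnorm M.
Proof. by case: M => [[[a b] c] d] /=; rewrite !addr_ge0 ?csq_ge0. Qed.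

(** The adjugate recovers det M times the vector of [p] from its image, and it has the same
    Frobenius norm as [M]; Cauchy-Schwarz on each coordinate gives the bound. *)
Lemma map_lower M p :
  csq (mdet M) * homn p <= mnorm M * (csq (mapx M p) + csq (mapy M p)).
Proof.
have [X [Y [eX eY]]] : exists X Y, mapx M p = X /\ mapy M p = Y by eexists; eexists.
rewrite /homn mulrDr -!csqM eX eY.
have csqN z : csq (- z) = csq z by case: z => u v /=; ring.
have ex : mdet M * homx p = (madj M).1.1.1 * X + (madj M).1.1.2 * Y.
  by rewrite -eX -eY; clear; case: M => [[[a b] c] d] /=; ring.
have ey : mdet M * homy p = (madj M).1.2 * X + (madj M).2 * Y.
  by rewrite -eX -eY; clear; case: M => [[[a b] c] d] /=; ring.
rewrite ex ey; case: (M) => [[[a b] c] d]; rewrite [madj _]/= /mnorm.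
have := csq_lincomb d X (-b) Y; have := csq_lincomb (-c) X a Y.
by rewrite !csqN /=; lra.
Qed.

Lemma mact_lipschitz M : mdet M != 0 ->
  exists2 L : R, 0 < L & forall p q, chordal (mact M p) (mact M q) <= L * chordal p q.
Proof.
move=> dM; have D0 : 0 < csq (mdet M) by rewrite csq_gt0.
have hL : 0 <= mnorm M / cabs (mdet M) by rewrite divr_ge0 ?mnorm_ge0 ?cabs_ge0.
(* Adding 1 makes the constant visibly positive. *)
exists (mnorm M / cabs (mdet M) + 1) => [|p q]; first lra.
apply: (@le_trans _ _ (mnorm M / cabs (mdet M) * chordal p q)); last first.
  by rewrite ler_wpM2r ?chordal_ge0 // lerDl.
rewrite -(ler_pXn2r (n := 2)) ?nnegrE ?mulr_ge0 ?chordal_ge0 ?mnorm_ge0 ?invr_ge0 ?cabs_ge0 //.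
rewrite exprMn expr_div_n sqr_cabs !chordal_hom.
have [k [k0 kx ky]] := mact_hom p dM; have [l [l0 lx ly]] := mact_hom q dM.
have P := map_lower M p; have Q := map_lower M q.
rewrite kx ky !csqM -mulrDr -/(homn (mact M p)) in P.
rewrite lx ly !csqM -mulrDr -/(homn (mact M q)) in Q.
set E := csq (homx (mact M p) * _ - _).
(* The cross product of two homogeneous vectors is multiplied by det M. *)
have hE : csq k * csq l * E = csq (mdet M) * csq (homx p * homy q - homy p * homx q).
  rewrite -!csqM; congr csq.
  transitivity (mapx M p * mapy M q - mapy M p * mapx M q).
    by rewrite kx ky lx ly; ring.
  by clear; case: M => [[[a b] c] d] /=; ring.
have K0 : 0 < csq k by rewrite csq_gt0.
have L0 : 0 < csq l by rewrite csq_gt0.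
move: E hE P Q K0 L0 D0 (homn_gt0 p) (homn_gt0 q) (homn_gt0 (mact M p)) (homn_gt0 (mact M q)).
move: (mnorm_ge0 M) (csq_ge0 (homx p * homy q - homy p * homx q)).
move: (csq k) (csq l) (csq (mdet M)) (homn p) (homn q) (homn (mact M p)) (homn (mact M q)).
move: (mnorm M) (csq (homx p * homy q - homy p * homx q)).
move=> S G K L D hp hq hp' hq' S0 G0 E hE P Q K0 L0 D0 hp0 hq0 hp'0 hq'0.
have -> : E = D * G / (K * L) by rewrite -hE; field; rewrite ?gt_eqF.
rewrite ler_pdivrMr ?mulr_gt0 //.
(* A common factor is pulled out of both sides, leaving the product of the lower bounds [P] and
   [Q]. *)
have -> : S ^+ 2 / D * (4 * G / (hp * hq)) * (hp' * hq') =
  4 * G / (D * hp * hq * K * L) * ((S * (K * hp')) * (S * (L * hq'))).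
  by field; rewrite ?gt_eqF.
have -> : 4 * (D * G / (K * L)) = 4 * G / (D * hp * hq * K * L) * ((D * hp) * (D * hq)).
  by field; rewrite ?gt_eqF.
apply: ler_wpM2l; last by apply: ler_pM => //; rewrite mulr_ge0 // ltW.
by rewrite divr_ge0 ?mulr_ge0 // ltW.
Qed.

Lemma chordal_finite x y : chordal (Some x) (Some y) <= 2 * cabs (x - y).
Proof.
rewrite /chordal ler_pdivrMr -/(cabs _).
  have h z : 1 <= Num.sqrt (1 + csq z).
    by rewrite -[leLHS]sqrtr1 ler_wsqrtr // lerDl csq_ge0.
  rewrite -[leLHS]mulr1 ler_wpM2l ?mulr_ge0 ?cabs_ge0 //.
  by rewrite -[leLHS]mulr1 ler_pM // h.
by rewrite mulr_gt0 // sqrtr_gt0 ltr_wpDr ?csq_ge0.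
Qed.

Lemma chart_ball M e : mdet M != 0 -> 0 < e -> exists2 d : R, 0 < d &
  forall x, cabs x < d -> chordal (mact M (Some 0)) (mact M (Some x)) < e.
Proof.
move=> /mact_lipschitz [L L0 ML] e0; exists (e / (2 * L)); first by rewrite divr_gt0 ?mulr_gt0.
move=> x; rewrite ltr_pdivlMr ?mulr_gt0 // => xd.
apply: le_lt_trans (ML _ _) _.
rewrite chordalC; apply: le_lt_trans xd.
have := chordal_finite x 0; rewrite subr0 => h.
by rewrite [leRHS]mulrA [leRHS]mulrC ler_pM2l // [_ * 2]mulrC.
Qed.

Lemma ball_chart M d : mdet M != 0 -> 0 < d -> exists2 e : R, 0 < e &
  forall p, chordal (mact M (Some 0)) p < e ->
    exists2 x, cabs x < d & p = mact M (Some x).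
Proof.
move=> dM d0; have [|L L0 ML] := @mact_lipschitz (madj M); first by rewrite mdet_adj.
have hd : 0 < 1 + d ^+ 2 by rewrite ltr_pwDl // sqr_ge0.
(* Before division by [L], this is the chordal distance from 0 to a point of modulus [d]. Infinity
   is at distance 2 from 0, hence farther. *)
exists (2 * d / (Num.sqrt (1 + d ^+ 2) * L)).
  by rewrite divr_gt0 ?mulr_gt0 ?sqrtr_gt0.
move=> p; rewrite invfM mulrA ltr_pdivlMr // => hp.
have {ML} : chordal (mact (madj M) (mact M (Some 0))) (mact (madj M) p) <
    2 * d / Num.sqrt (1 + d ^+ 2).
  by apply: le_lt_trans (ML _ _) _; rewrite mulrC.
rewrite mactK // -{2}[p](mactVK _ dM).
case: (mact _ p) => [x|]; last first.
  rewrite /chordal (_ : csq 0 = 0) ?addr0 ?sqrtr1 ?divr1; last by rewrite /=; ring.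
  rewrite ltr_pdivlMr ?sqrtr_gt0 // ltr_pM2l //.
  rewrite -[ltRHS]ger0_norm ?(ltW d0) // -sqrtr_sqr ltr_sqrt ?exprn_gt0 //; lra.
move=> h; exists x => //; move: h; apply: contraTT; rewrite -!leNgt => dx.
rewrite -(ler_pXn2r (n := 2)) ?nnegrE ?chordal_ge0 ?divr_ge0 ?mulr_ge0 ?sqrtr_ge0 ?(ltW d0) //.
rewrite chordal_hom /homn /homx /homy expr_div_n exprMn sqr_sqrtr ?(ltW hd) //.
rewrite mul0r mul1r sub0r.
have -> : csq (1 : R[i]) = 1 by rewrite /=; ring.
have -> : csq (0 : R[i]) = 0 by rewrite /=; ring.
have -> : csq (-x) = csq x by case: (x) => u v /=; ring.
have : d ^+ 2 <= csq x by rewrite -sqr_cabs ler_pXn2r ?nnegrE ?cabs_ge0 ?(ltW d0).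
move: (csq x) (d ^+ 2) hd (sqr_ge0 d) => u v v1 v0 vu.
(* Both squared distances have the form 4 - 4/(1 + t), which increases with t. *)
have -> : 4 * u / ((0 + 1) * (u + 1)) = 4 - 4 / (1 + u) by field; lra.
have -> : 2 ^+ 2 * v / (1 + v) = 4 - 4 / (1 + v) by field; lra.
by rewrite lerD2l lerN2 ler_pM2l // lef_pV2 ?posrE; lra.
Qed.

(** * Normal forms at a fixed point *)

Lemma mact_intertwine M N (D : mob R) (k : R[i]) p : mdet M != 0 -> mdet N != 0 -> k != 0 ->
  mmul M N = mob_scale k (mmul N D) -> mact M (mact N p) = mact N (mact D p).
Proof.
move=> dM dN k0 e; have dD : mdet D != 0.
  have := congr1 (@mdet R) e; rewrite mdet_scale !mdet_mul => e'.
  have : mdet M * mdet N != 0 by rewrite mulf_neq0.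
  by rewrite e' !mulf_eq0 !negb_or => /and3P[].
by rewrite -!mact_mul // e mact_scale // mdet_mul mulf_neq0.
Qed.

(* For finite [p] the second fixed point is spanned by the first column of [M - l], [l] being the eigenvalue at [p]. *)
Lemma conj_diag M p : mdet M != 0 -> mact M p = p -> mult M p != 1 ->
  [/\ mult M p != 0 & exists2 N, mdet N != 0 & mact N (Some 0) = p /\
    forall q, mact M (mact N q) = mact N (mact (mult M p, 0, 0, 1) q)].
Proof.
move=> dM fM m1.
have [l [l0 lx ly]] := mact_hom p dM; rewrite fM in lx ly.
case: M dM fM m1 lx ly => [[[a b] c] d] dM _.
case: p => [w|] m1 lx ly; rewrite /mapx /mapy /homx /homy ?mulr1 ?mulr0 ?addr0 in lx ly.
(* The eigenvalue at [w] is l = c w + d and the other one is a - c w; the multiplier is their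
   ratio. *)
- have mE : mult (a, b, c, d) (Some w) = (a - c * w) / l.
    rewrite /mult ly; apply: (mulIf (expf_neq0 2 l0)).
    rewrite divfK ?expf_neq0 // expr2 mulrA divfK //.
    have -> : b = l * w - a * w by rewrite -lx; ring.
    by rewrite -ly; ring.
  rewrite mE in m1 *.
  have ne : a - c * w - l != 0.
    by apply: contra m1; rewrite subr_eq0 => /eqP ->; rewrite divff.
  have eb : b = l * w - a * w by rewrite -lx; ring.
  have ed : d = l - c * w by rewrite -ly; ring.
  have dE : (a - c * w) * l = mdet (a, b, c, d) by rewrite /mdet eb ed; ring.
  split; first by rewrite mulf_neq0 ?invr_eq0 //; apply: contra dM => /eqP e; rewrite -dE e mul0r.
  (* By Cayley-Hamilton the first column of M - l is an eigenvector for the other eigenvalue. *)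
  have dN : mdet (a - l, w, c, 1) != 0 by rewrite /mdet mulr1 [w * c]mulrC addrAC.
  exists (a - l, w, c, 1) => //; split.
    by rewrite /mact !mulr0 !add0r oner_eq0 divr1.
  move=> q; apply: (@mact_intertwine _ _ _ l) => //; rewrite /mmul /mob_scale.
  congr (_, _, _, _); rewrite ?eb ?ed; try ring; field => //.
- have mE : mult (a, b, c, d) None = d / a by [].
  rewrite mE lx ly in m1 dM *; rewrite /mdet mulr0 subr0 in dM.
  have d0 : d != 0 by apply: contra dM => /eqP ->; rewrite mulr0.
  have ne : d - l != 0.
    by apply: contra m1; rewrite subr_eq0 => /eqP ->; rewrite divff.
  split; first by rewrite mulf_neq0 ?invr_eq0.
  (* Here [M] is affine, with finite fixed point b / (d - l); the chart sends infinity to it and 0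
     to infinity. *)
  have dN : mdet (b / (d - l), 1, 1, 0) != 0 :> R[i].
    by rewrite /mdet mulr0 mulr1 sub0r oppr_eq0 oner_eq0.
  exists (b / (d - l), 1, 1, 0) => //; split; first by rewrite /mact mulr0 addr0 eqxx.
  move=> q; apply: (@mact_intertwine _ _ _ l) => //; rewrite /mmul /mob_scale ?/mdet ?mulr0 ?subr0 //.
  congr (_, _, _, _); field; rewrite ?ne ?l0 //.
Qed.

(** Multiplier 1 means a double eigenvalue [l], and M is not scalar since it is not the identity
    map. The columns of [N] form a Jordan basis, scaled so that M N = l N (1, 1, 0, 1). *)
Lemma conj_translation M p : mdet M != 0 -> mact M p = p -> mult M p = 1 ->
  mact M <> id ->
  exists2 N, mdet N != 0 & mact N None = p /\
    forall q, mact M (mact N q) = mact N (mact (1, 1, 0, 1) q).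
Proof.
move=> dM fM m1 nid.
have [l [l0 lx ly]] := mact_hom p dM; rewrite fM in lx ly.
case: M dM fM m1 nid lx ly => [[[a b] c] d] dM _.
case: p => [w|] m1 nid lx ly; rewrite /mapx /mapy /homx /homy ?mulr1 ?mulr0 ?addr0 in lx ly.
- have eb : b = l * w - a * w by rewrite -lx; ring.
  have ed : d = l - c * w by rewrite -ly; ring.
  have ea : a = l + c * w.
    move: m1; rewrite /mult ly eb ed => m1.
    apply: (mulIf l0); transitivity (l ^+ 2 + c * w * l); last by ring.
    rewrite -[X in X + _]mul1r -m1 divfK ?expf_neq0 //; ring.
  have c0 : c != 0.
    apply/eqP => c0; apply: nid; apply: functional_extensionality_dep => q.
    rewrite -[RHS]mact1 -[RHS](@mact_scale l) //; last first.
      by rewrite /mdet mulr1 mulr0 subr0 oner_eq0.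
    congr (mact _ q); rewrite /mob_scale eb ed ea c0; congr (_, _, _, _); ring.
  have dN : mdet (w, l / c, 1, 0) != 0.
    by rewrite /mdet mulr0 sub0r oppr_eq0 mulr1 mulf_neq0 ?invr_eq0.
  exists (w, l / c, 1, 0) => //; split.
    by rewrite /mact oner_eq0 divr1.
  move=> q; apply: (@mact_intertwine _ _ _ l) => //; rewrite /mmul /mob_scale.
  by congr (_, _, _, _); rewrite ?eb ?ed ?ea; field.
- rewrite lx ly in m1 nid dM *; rewrite /mult in m1.
  have {m1} ed : d = l by rewrite -[RHS]mul1r -m1 divfK.
  have b0 : b != 0.
    apply/eqP => b0; apply: nid; apply: functional_extensionality_dep => q.
    rewrite -[RHS]mact1 -[RHS](@mact_scale l) //; last first.
      by rewrite /mdet mulr1 mulr0 subr0 oner_eq0.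
    congr (mact _ q); rewrite /mob_scale ed b0; congr (_, _, _, _); ring.
  have dN : mdet (b / l, 0, 0, 1) != 0 :> R[i].
    by rewrite /mdet mulr0 mulr1 subr0 mulf_neq0 ?invr_eq0.
  exists (b / l, 0, 0, 1) => //; split; first by rewrite /mact eqxx.
  move=> q; apply: (@mact_intertwine _ _ _ l) => //; rewrite /mmul /mob_scale.
  congr (_, _, _, _); rewrite ?ed; field; rewrite ?l0 ?c0 ?b0 //.
Qed.

(** * Model maps: scaling, translation, inversion *)

Lemma mact_diag m x : mact (m, 0, 0, 1) (Some x) = Some (m * x).
Proof. by rewrite /mact mul0r add0r oner_eq0 addr0 divr1. Qed.

Lemma mact_translation a x : mact (1, a, 0, 1) (Some x) = Some (x + a).
Proof. by rewrite /mact mul0r add0r oner_eq0 mul1r divr1. Qed.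

Lemma mact_inversion x : x != 0 -> mact (0, 1, 1, 0) (Some x^-1) = Some x.
Proof. by move=> x0; rewrite /mact mul1r mul0r addr0 add0r invr_eq0 (negPf x0) mul1r invrK. Qed.

Lemma mact_inversion0 : mact (0, 1, 1, 0) (Some 0) = None :> sphere R.
Proof. by rewrite /mact mulr0 addr0 eqxx. Qed.

Lemma mdet_inversion : mdet (0, 1, 1, 0) != 0 :> R[i].
Proof. by rewrite /mdet mul0r mulr1 sub0r oppr_eq0 oner_eq0. Qed.

Lemma iter_conj M N D n p : (forall q, mact M (mact N q) = mact N (mact D q)) ->
  iter n (mact M) (mact N p) = mact N (iter n (mact D) p).
Proof. by move=> conj; elim: n => // n IH; rewrite !iterS IH conj. Qed.

Lemma iter_diag m n x : iter n (mact (m, 0, 0, 1)) (Some x) = Some (m ^+ n * x).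
Proof.
elim: n => [|n IH]; first by rewrite expr0 mul1r.
by rewrite iterS IH mact_diag mulrA exprS.
Qed.

Lemma iter_translation n x : iter n (mact (1, 1, 0, 1)) (Some x) = Some (x + n%:R).
Proof.
elim: n => [|n IH]; first by rewrite addr0.
by rewrite iterS IH mact_translation -addrA natr1.
Qed.

Lemma ler_reP x : reP x <= cabs x.
Proof.
case: x => a b; rewrite /cabs /=; apply: le_trans (ler_norm _) _.
by rewrite -sqrtr_sqr ler_wsqrtr // lerDl sqr_ge0.
Qed.

Lemma ler_norm_reP x : `|reP x| <= cabs x.
Proof.
case: x => a b; rewrite /cabs /=.
by rewrite -sqrtr_sqr ler_wsqrtr // lerDl sqr_ge0.
Qed.

Lemma rePD x y : reP (x + y) = reP x + reP y.
Proof. by case: x; case: y. Qed.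

Lemma reP_nat n : reP (n%:R : R[i]) = n%:R.
Proof. by elim: n => [//|n IH]; rewrite -!natr1 rePD IH. Qed.

Lemma cabsV x : cabs x^-1 = (cabs x)^-1.
Proof.
have c0 : cabs (0 : R[i]) = 0 by rewrite /cabs /= !expr0n addr0 sqrtr0.
have c1 : cabs (1 : R[i]) = 1 by rewrite /cabs /= expr1n expr0n addr0 sqrtr1.
have [->|x0] := eqVneq x 0; first by rewrite invr0 c0 invr0.
have nx : cabs x != 0 by rewrite gt_eqF // cabs_gt0.
by apply: (mulfI nx); rewrite -cabsM !divff.
Qed.

Lemma cabs_inv_lt (r : R) x : 0 < r -> r < cabs x -> x != 0 /\ cabs x^-1 < r^-1.
Proof.
move=> r0 rx; have x0 : 0 < cabs x by exact: lt_trans rx.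
by rewrite -cabs_gt0 cabsV ltf_pV2 ?posrE.
Qed.

Lemma chart_ball_infty N (e : R) : mdet N != 0 -> 0 < e -> exists2 r : R, 0 < r &
  forall x, r < cabs x -> chordal (mact N None) (mact N (Some x)) < e.
Proof.
move=> dN e0; have [|d d0 hd] := @chart_ball (mmul N (0, 1, 1, 0)) _ _ e0.
  by rewrite mdet_mul mulf_neq0 ?mdet_inversion.
exists d^-1; first by rewrite invr_gt0.
move=> x; rewrite -invr_gt0 in d0 => /(cabs_inv_lt d0)[x0]; rewrite invrK => /hd.
by rewrite !mact_mul ?mdet_inversion // mact_inversion0 mact_inversion.
Qed.

Lemma expr_unbounded (a c : R) : 1 < a -> exists n, c < a ^+ n.
Proof.
move=> a1; have bern n : n%:R * (a - 1) <= a ^+ n.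
  elim: n => [|n IH]; first by rewrite mul0r.
  rewrite exprS -natr1; have : 1 <= a ^+ n by rewrite exprn_ege1 // ltW.
  by nra.
exists (Num.bound `|c / (a - 1)|); apply: lt_le_trans (bern _).
rewrite -ltr_pdivrMr ?subr_gt0 //.
by apply: le_lt_trans (ler_norm _) _; apply: archi_boundP; rewrite normr_ge0.
Qed.
End RiemannSphere.

Section Dynamics.
Variable R : realType.
Variable F : PMT R.
Implicit Types (x y : R[i]) (z w : sphere R) (M N : mob R) (g : R -> sphere R).

(** * Möbius maps along an orbit *)

Lemma mobAt_reg k w : reg (p := F) k w -> mobAt F w = Defs.fmap k.
Proof.
move=> kw; rewrite /mobAt /regionOf; case: pickP => [j /asboolP jw|/(_ k)/asboolP//].
have [->//|/reg_disj] := eqVneq j k.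
by move/seteqP => [/(_ w) h _]; case: h.
Qed.

Lemma mdet_mobAt w : mdet (mobAt F w) != 0.
Proof.
rewrite /mobAt; case: regionOf => [k|]; first exact: fmap_det.
by rewrite /mdet /mid mulr1 mulr0 subr0 oner_eq0.
Qed.

Lemma mdet_Mz n z : mdet (Mz F n z) != 0.
Proof.
elim: n => [|n IH] /=; first by rewrite /mid mulr1 mulr0 subr0 oner_eq0.
by rewrite mdet_mul mulf_neq0 ?mdet_mobAt.
Qed.

Lemma mact_MzS n z w :
  mact (Mz F n.+1 z) w = mact (mobAt F (Fit F n z)) (mact (Mz F n z) w).
Proof. by rewrite /= mact_mul ?mdet_mobAt ?mdet_Mz. Qed.

Lemma Fit_Mz n z : Fit F n z = mact (Mz F n z) z.
Proof. by elim: n => [|n IH]; rewrite ?mact1 // mact_MzS -IH. Qed.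

Lemma FitD m n z : Fit F (m + n) z = Fit F m (Fit F n z).
Proof. by rewrite /Fit iterD. Qed.

Lemma Fit_mul p n z : Fit F p z = z -> Fit F (n * p) z = z.
Proof. by move=> pz; elim: n => [//|n IH]; rewrite mulSn FitD IH. Qed.

(** The orbit of [z] is back at [z] after [p] steps, so its itinerary restarts there. *)
Lemma mact_MzD m p z w : Fit F p z = z ->
  mact (Mz F (m + p) z) w = mact (Mz F m z) (mact (Mz F p z) w).
Proof.
move=> pz; elim: m => [|m IH]; first by rewrite mact1.
by rewrite addSn !mact_MzS IH FitD pz.
Qed.

Lemma mact_Mz_mul p n z w : Fit F p z = z ->
  mact (Mz F (n * p) z) w = iter n (mact (Mz F p z)) w.
Proof.
move=> pz; elim: n w => [|n IH] w; first by rewrite mact1.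
by rewrite mulSn addnC mact_MzD // IH -iterSr.
Qed.

(** * Regions and the discontinuity set *)

Lemma RF_notBF w : RF F w -> ~ BF F w.
Proof.
move=> [k kw] [j [cj nj]]; have [e e0 ke] := reg_open kw.
have [jk|/reg_disj/seteqP[jk _]] := eqVneq j k; first by apply: nj; rewrite jk; exists e.
have [u [ju wu]] := cj _ e0.
by apply: (jk u); split=> //; apply: ke.
Qed.

(** The closed regions cover the sphere, and a point of a closure is either interior or on the
    boundary. *)
Lemma notBF_RF w : ~ BF F w -> RF F w.
Proof.
move=> nB; have [k ck] : exists k, sclosure (reg (p := F) k) w.
  by have /seteqP[_ /(_ w)] := reg_cover F; apply.
have [[e e0 ke]|nint] := pselect (sinterior (reg (p := F) k) w).
  by exists k; apply: ke; rewrite /sball /= chordalxx.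
by exfalso; apply: nB; exists k.
Qed.

Lemma two_BF_points : exists w1 w2, [/\ BF F w1, BF F w2 & w1 <> w2].
Proof.
have [k _] : exists k, sclosure (reg (p := F) k) None.
  by have /seteqP[_ /(_ None)] := reg_cover F; apply.
have [m [g [m0 jg bg]]] := reg_bdry k.
have [_ _ inj _] := jg _ m0.
exists (g 0%N 0), (g 0%N (1 / 2)); split; try by (exists k; rewrite bg; exists 0%N => //; eexists).
by move=> /inj h; have := h ltac:(lra) ltac:(lra); lra.
Qed.

(* Replaces the connectedness of small discs: a path that avoids [BF] cannot change region. *)
Lemma path_in_region g k : (forall t, scont_at g t) ->
  (forall t, 0 <= t <= 1 -> RF F (g t)) -> reg (p := F) k (g 0) ->
  forall t, 0 <= t <= 1 -> reg (p := F) k (g t).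
Proof.
move=> gc gR k0.
have opn j : open [set t | reg (p := F) j (g t)].
  rewrite openE => t jt; have [e e0 je] := reg_open jt.
  have [d d0 dt] := gc t e e0.
  apply/nbhs_ballP; exists d => //= s; rewrite /ball /= => st.
  by apply: je; rewrite /sball /= chordalC; apply: dt; rewrite distrC.
have itv01 t : `[0%R, 1%R]%classic t <-> 0 <= t <= 1 by rewrite /= in_itv.
(* The parameters sent into region [k] form a nonempty, relatively open and closed subset of [0, 1];
   closedness holds because the remaining parameters lie in the other open regions. *)
have e : [set t | (0 <= t <= 1) /\ reg (p := F) k (g t)] = `[0%R, 1%R]%classic; last first.
  move=> t t01; have : `[0%R, 1%R]%classic t by apply/itv01.
  by rewrite -e => -[].
apply: segment_connected.
- by exists 0; split=> //; lra.
- exists [set t | reg (p := F) k (g t)]; first exact: opn.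
  by apply/seteqP; split=> t [/itv01 t01 kt]; split=> //; apply/itv01.
- exists (~` \bigcup_(j in [set j | j != k]) [set t | reg (p := F) j (g t)]).
    by apply: open_closedC; apply: bigcup_open => j _; apply: opn.
  apply/seteqP; split=> t [/itv01 t01 h]; split=> //.
  + move=> [j /reg_disj/seteqP[jk _] jt].
    by apply: (jk (g t)).
  + have [j jt] := gR t t01; have [<-//|jk] := eqVneq j k.
    by exfalso; apply: h; exists j.
Qed.

(** * Common itineraries along paths *)

Lemma mact_scont M g t : mdet M != 0 -> scont_at g t ->
  scont_at (fun s => mact M (g s)) t.
Proof.
move=> /mact_lipschitz[L L0 ML] gc e e0.
have [|d d0 gd] := gc (e / L); first by rewrite divr_gt0.
exists d => // s /gd; rewrite ltr_pdivlMr // mulrC; exact: le_lt_trans (ML _ _).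
Qed.

Lemma segment_scont x t : scont_at (fun s : R => Some (s%:C%C * x)) t.
Proof.
move=> e e0; have h : 0 < 2 * (cabs x + 1) by have := cabs_ge0 x; lra.
exists (e / (2 * (cabs x + 1))); first by rewrite divr_gt0.
move=> s; rewrite ltr_pdivlMr // => se.
apply: le_lt_trans (chordal_finite _ _) _; apply: le_lt_trans se.
rewrite -mulrBl -rmorphB cabsM.
have -> : cabs (s - t)%:C%C = `|s - t|.
  by rewrite /cabs /= expr0n addr0 sqrtr_sqr.
by have := normr_ge0 (s - t); have := cabs_ge0 x; nra.
Qed.

(** Induction on [n]: on the path, F^n is a single Möbius map, so the image path is continuous. It
    stays in [RF], hence in one region, and the next map applied is the same as at [g 0]. *)
Lemma path_itinerary g : (forall t, scont_at g t) ->
  (forall t, 0 <= t <= 1 -> ~ preB_union F (g t)) ->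
  forall n t, 0 <= t <= 1 ->
    RF F (Fit F n (g t)) /\ Fit F n (g t) = mact (Mz F n (g 0)) (g t).
Proof.
move=> gc gB n.
(* A first exit from [RF] would land in [BF], making [g t] a pre-discontinuity point. *)
have stay t m : 0 <= t <= 1 -> (forall j, (j < m)%N -> RF F (Fit F j (g t))) ->
    RF F (Fit F m (g t)).
  by move=> t01 h; apply: notBF_RF => B; apply: (gB t t01); exists m.
have RFt m t : 0 <= t <= 1 -> RF F (Fit F m (g t)).
  by move=> t01; elim/ltn_ind: m => m IH; apply: stay.
elim: n => [|n IH] t t01; split; try exact: RFt; first by rewrite mact1.
have [_ e] := IH t t01.
rewrite mact_MzS -e /Fit iterS -/(Fit F n (g t)) /Fmap; congr (mact _ _).
have z01 : 0 <= (0 : R) <= 1 by lra.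
have [k k0] := RFt n _ z01.
rewrite (mobAt_reg k0) e; apply: mobAt_reg.
rewrite (IH _ z01).2 in k0.
apply: (@path_in_region (fun s => mact (Mz F n (g 0)) (g s))) => //.
  by move=> s; apply: mact_scont => //; apply: mdet_Mz.
by move=> s s01; rewrite -(IH s s01).2; apply: RFt.
Qed.

Lemma regular_itinerary N z : mdet N != 0 -> mact N (Some 0) = z ->
  ~ preB F z -> exists2 d : R, 0 < d & forall x, cabs x < d -> forall n,
    RF F (Fit F n (mact N (Some x))) /\
    Fit F n (mact N (Some x)) = mact (Mz F n z) (mact N (Some x)).
Proof.
move=> dN Nz nB.
have [e [e0 he]] : exists e : R, 0 < e /\ forall w, chordal z w < e -> ~ preB_union F w.
  apply: contrapT => ne; apply: nB => e e0; apply: contrapT => nw.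
  by apply: ne; exists e; split=> // w zw Bw; apply: nw; exists w.
have [d d0 hd] := chart_ball dN e0; exists d => // x xd n.
(* Radial path from [z] to the point of coordinate [x], within the chart disc. *)
pose g t := mact N (Some (t%:C%C * x)).
have g0 : g 0 = z by rewrite /g mul0r.
have g1 : g 1 = mact N (Some x) by rewrite /g mul1r.
rewrite -g1 -g0; apply: path_itinerary.
- by move=> t; apply: mact_scont => //; apply: segment_scont.
- move=> t t01; apply: he; rewrite -Nz; apply: hd.
  rewrite cabsM /cabs /= expr0n addr0 sqrtr_sqr -/(cabs x).
  apply: le_lt_trans xd; rewrite ger0_norm; last by lra.
  by have := cabs_ge0 x; nra.
- lra.
Qed.

(** * Periodic points and regularity *)

Lemma periodic_notin_preB_union p z : Defs.periodic F p z -> ~ preB_union F z.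
Proof. by move=> [_ zR _] [n [_ B]]; exact: RF_notBF (zR n) B. Qed.

(** For finitely many steps, openness of the regions and Lipschitz continuity suffice, without
    regularity of [z]; the radius depends on [n]. *)
Lemma periodic_follow n z : (forall j, RF F (Fit F j z)) ->
  exists2 e : R, 0 < e & forall w, chordal z w < e ->
    (forall j, (j < n)%N -> RF F (Fit F j w)) /\ Fit F n w = mact (Mz F n z) w.
Proof.
move=> zR; elim: n => [|n [e e0 IH]].
  by exists 1 => // w _; split=> //; rewrite mact1.
have [k kz] := zR n; have [r r0 kr] := reg_open kz.
have [L L0 ML] := mact_lipschitz (mdet_Mz n z).
exists (Num.min e (r / L)); first by rewrite lt_min e0 divr_gt0.
move=> w; rewrite lt_min => /andP[/IH [wR we]]; rewrite ltr_pdivlMr // mulrC => wr.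
have kw : reg (p := F) k (Fit F n w).
  by rewrite we; apply: kr; rewrite /sball /= Fit_Mz; apply: le_lt_trans (ML _ _) wr.
split.
  by move=> j; rewrite ltnS leq_eqVlt => /orP[/eqP->|/wR//]; exists k.
by rewrite mact_MzS -we (mobAt_reg kz) -(mobAt_reg kw).
Qed.

Lemma invariant_RF p (V : set (sphere R)) : (0 < p)%N ->
  (forall w, V w -> (forall j, (j < p)%N -> RF F (Fit F j w)) /\ V (Fit F p w)) ->
  forall w, V w -> forall j, RF F (Fit F j w).
Proof.
move=> p0 inv w Vw j; elim/ltn_ind: j w Vw => j IH w Vw.
have [wR Vp] := inv w Vw; have [/wR//|pj] := ltnP j p.
by rewrite -(subnK pj) FitD; apply: IH => //; rewrite ltn_subrL p0 (leq_trans p0).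
Qed.

Lemma regular_ball z : (exists2 e : R, 0 < e &
    forall w, chordal z w < e -> forall j, RF F (Fit F j w)) -> regularF F z.
Proof.
move=> [e e0 h] /(_ e e0)[w [[n [_ B]] zw]].
exact: RF_notBF (h w zw n) B.
Qed.

(** A regular periodic point is its own limit point: it returns at every multiple of [p]. *)
Lemma periodic_omega p z : Defs.periodic F p z -> regularF F z -> omegaF F z.
Proof.
move=> [p0 _ pz] zr; exists z => // e e0 n; exists (n * p)%N.
  by rewrite leq_pmulr.
by rewrite Fit_mul // chordalxx.
Qed.

Lemma Per_id_regular z : Per_id F z -> regularF F z.
Proof.
move=> [p [[p0 zR pz] [e e0 he]]]; apply: regular_ball; exists e => // w zw.
apply: (@invariant_RF p [set w | chordal z w < e]) => // u /= zu.
by have [uR ->] := he u zu.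
Qed.

(* In a chart centred at [z] in which the return map is [x |-> m x], small discs are forward invariant. *)
Lemma nonexpanding_regular p z : Defs.periodic F p z ->
  mult (Mz F p z) z != 1 -> `|mult (Mz F p z) z| <= 1 -> regularF F z.
Proof.
move=> [p0 zR pz] m1; rewrite normc_cabs lecR => mle.
have fM : mact (Mz F p z) z = z by rewrite -Fit_Mz.
have [_ [N dN [Nz conj]]] := conj_diag (mdet_Mz p z) fM m1.
(* Nested neighbourhoods: the ball of radius [e] follows [z] for one period, the chart disc of
   radius [d] lies in it, and the ball of radius [r] lies in that disc. *)
have [e e0 he] := periodic_follow p zR.
have [d d0 hd] := chart_ball dN e0; rewrite Nz in hd.
have [r r0 hr] := ball_chart dN d0; rewrite Nz in hr.
apply: regular_ball; exists r => // w /hr[x xd ->].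
apply: (@invariant_RF p [set w | exists2 x, cabs x < d & w = mact N (Some x)]) => //; last by exists x.
move=> _ [y yd ->]; have [yR ye] := he _ (hd y yd); split=> //.
exists (mult (Mz F p z) z * y).
  by rewrite cabsM; apply: le_lt_trans yd; rewrite ler_piMl ?cabs_ge0.
by rewrite ye conj mact_diag.
Qed.

(** * Repelling and parabolic points *)

(** Otherwise [BF] would be contained in the single point N(infinity). *)
Lemma no_RF_plane N : mdet N != 0 -> ~ (forall x, RF F (mact N (Some x))).
Proof.
move=> dN key; have far w : BF F w -> w = mact N None.
  move=> Bw; rewrite -(mactVK w dN); case E: (mact _ w) => [y|//].
  exfalso; apply: RF_notBF Bw; rewrite -(mactVK w dN) E; exact: key.
have [w1 [w2 [/far -> /far ->]]] := two_BF_points.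
exact.
Qed.

Lemma Per_rep_alpha z : Per_rep F z -> alphaF F z.
Proof.
move=> [p [pp _]]; rewrite normc_cabs ltcR => m1.
split; last exact: periodic_notin_preB_union pp.
apply: contrapT => nB; have [p0 zR pz] := pp.
have fM : mact (Mz F p z) z = z by rewrite -Fit_Mz.
have mn1 : mult (Mz F p z) z != 1.
  by apply: contraTneq m1 => ->; rewrite /cabs /= expr1n expr0n addr0 sqrtr1 ltxx.
have [m0 [N dN [Nz conj]]] := conj_diag (mdet_Mz p z) fM mn1.
have [d d0 hd] := regular_itinerary dN Nz nB.
move: (mult _ _) m1 {mn1} m0 conj => m m1 m0 conj.
have key y : RF F (mact N (Some y)).
  (* For this [n], y / m^n lies in the disc that follows [z], and n returns carry it to y. *)
  have [n hn] : exists n, cabs y / d < cabs m ^+ n.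
    exact: expr_unbounded.
  have /hd/(_ (n * p)%N)[+ e] : cabs (y / m ^+ n) < d.
    rewrite cabsM cabsV cabsX ltr_pdivrMr; last by rewrite exprn_gt0 // (lt_trans _ m1).
    by rewrite mulrC -ltr_pdivrMr.
  rewrite e mact_Mz_mul //.
  by rewrite (iter_conj _ _ conj) iter_diag mulrC divfK ?expf_neq0.
exact: no_RF_plane dN key.
Qed.

Lemma Per_par_alpha z : Per_par F z -> alphaF F z.
Proof.
move=> [p [pp _ m1 nid]].
split; last exact: periodic_notin_preB_union pp.
apply: contrapT => nB; have [p0 zR pz] := pp.
have fM : mact (Mz F p z) z = z by rewrite -Fit_Mz.
have [N dN [Nz conj]] := conj_translation (mdet_Mz p z) fM m1 nid.
(* The inversion moves [z] from infinity to the centre 0 of the chart. *)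
have dJ : mdet (mmul N (0, 1, 1, 0)) != 0 by rewrite mdet_mul mulf_neq0 ?mdet_inversion.
have Jz : mact (mmul N (0, 1, 1, 0)) (Some 0) = z.
  by rewrite mact_mul ?mdet_inversion // mact_inversion0.
have [d d0 hd] := regular_itinerary dJ Jz nB.
apply: (no_RF_plane dN) => y.
(* The real part of y - n is below -1/d, so its inverse lies in the disc of radius [d]; n unit
   translations lead back to y. *)
pose n := Num.bound `|reP y + d^-1|.
have [||u0] := @cabs_inv_lt _ d^-1 (y - n%:R); first by rewrite invr_gt0.
  apply: lt_le_trans (ler_norm_reP _).
  have -> : reP (y - n%:R) = reP y - n%:R.
    by rewrite -[in RHS](subrK n%:R y) [in RHS]rePD reP_nat addrK.
  rewrite distrC; apply: lt_le_trans (ler_norm _); rewrite ltrBrDl.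
  by apply: le_lt_trans (ler_norm _) _; apply: archi_boundP.
rewrite invrK => /hd/(_ (n * p)%N)[+ e]; rewrite e mact_Mz_mul //.
rewrite mact_mul ?mdet_inversion // mact_inversion //.
by rewrite (iter_conj _ _ conj) iter_translation subrK.
Qed.

(* The attracting petal: the half-plane [Re > r] in a chart where the return map is [x |-> x + 1]. *)
Lemma Per_par_omega z : Per_par F z -> omegaF F z.
Proof.
move=> [p [[p0 zR pz] _ m1 nid]].
have fM : mact (Mz F p z) z = z by rewrite -Fit_Mz.
have [N dN [Nz conj]] := conj_translation (mdet_Mz p z) fM m1 nid.
have [e e0 he] := periodic_follow p zR.
have [r r0 hr] := chart_ball_infty dN e0; rewrite Nz in hr.
have step y : r < reP y -> (forall j, (j < p)%N -> RF F (Fit F j (mact N (Some y)))) /\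
    Fit F p (mact N (Some y)) = mact N (Some (y + 1)).
  move=> ry; have [yR ->] := he _ (hr y (lt_le_trans ry (ler_reP y))).
  by rewrite conj mact_translation.
have petal y : r < reP y -> forall j, RF F (Fit F j (mact N (Some y))).
  move=> ry; apply: (@invariant_RF p
    [set w | exists2 x, r < reP x & w = mact N (Some x)]) => //; last by exists y.
  move=> _ [x rx ->]; have [xR ->] := step x rx; split=> //.
  by exists (x + 1) => //; rewrite rePD /=; lra.
pose q := (r + 1)%:C%C.
have qr : r < reP q by rewrite /=; lra.
(* The regular witness cannot be [z], which belongs to [alphaF]; it is a point of the petal whose
   orbit tends to [z]. *)
exists (mact N (Some q)).
  have dT : mdet (mmul N (1, q, 0, 1)) != 0.
    by rewrite mdet_mul mulf_neq0 // /mdet mulr1 mulr0 subr0 oner_eq0.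
  have Tq x : mact (mmul N (1, q, 0, 1)) (Some x) = mact N (Some (x + q)).
    by rewrite mact_mul ?mact_translation // /mdet mulr1 mulr0 subr0 oner_eq0.
  (* Since Re q = r + 1, the unit disc about [q] stays inside the half-plane Re > r. *)
  have [s s0 hs] := ball_chart dT (@ltr01 R).
  rewrite Tq add0r in hs.
  apply: regular_ball; exists s => // w /hs[x x1 ->].
  rewrite Tq; apply: petal; rewrite rePD /=.
  have := le_trans (ler_norm (- reP x)) (_ : _ <= cabs x).
  by rewrite normrN => /(_ (ler_norm_reP x)); lra.
move=> e' e'0 n0; have [s s0 hs] := chart_ball_infty dN e'0; rewrite Nz in hs.
(* The summand [n0] makes the time late enough; the bound on [s] pushes the real part beyond [s]. *)
pose n := (n0 + Num.bound s)%N.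
have iterq m : Fit F (m * p) (mact N (Some q)) = mact N (Some (q + m%:R)).
  elim: m => [|m IH]; first by rewrite addr0.
  rewrite mulSn FitD IH (step _ _).2 ?addrA -?natr1 ?addrA //.
  rewrite rePD reP_nat; have := ler0n R m; rewrite /=; lra.
exists (n * p)%N; first by rewrite (@leq_trans n) ?leq_addr ?leq_pmulr.
rewrite iterq chordalC; apply: hs; apply: lt_le_trans (ler_reP _).
rewrite rePD reP_nat natrD.
have := archi_boundP (ltW s0); have := ler0n R n0; rewrite /=; lra.
Qed.

End Dynamics.

Theorem mainTheorem3 (R : realType) (F : PMT R) :
  [/\ Per_rep F `|` Per_par F `<=` alphaF F,
      alphaF F `<=` preB F,
      Per_attr F `|` Per_par F `|` Per_ell F `|` Per_id F `<=` omegaF F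
    & Per_attr F `|` Per_ell F `|` Per_id F `<=` regularF F].
Proof.
have attr z : Per_attr F z -> exists2 p, Defs.periodic F p z & regularF F z.
  move=> [p [pp _ m1]]; exists p => //; apply: nonexpanding_regular pp _ (ltW m1).
  by apply: contraTneq m1 => ->; rewrite normr1 ltxx.
have ell z : Per_ell F z -> exists2 p, Defs.periodic F p z & regularF F z.
  by move=> [p [pp _ m1 mn1]]; exists p => //; apply: nonexpanding_regular pp mn1 _; rewrite m1.
split.
- by move=> z [/Per_rep_alpha|/Per_par_alpha].
- by move=> z [].
(* Only parabolic points need a limit from another orbit; the other types are regular and
   periodic. *)
- move=> z [[[/attr[p]|/Per_par_omega//]|/ell[p]]|zid]; try exact: periodic_omega.
  by have [p [pp _]] := zid; apply: periodic_omega pp _; apply: Per_id_regular.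
- by move=> z [[/attr[]|/ell[]]|/Per_id_regular].
Qed.
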